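(* Let $T>0$ and $H\in(0,1/2)$. For $k\ge1$ let $$c_k:=\frac{2}{T}\int_0^T t^{2H}\cos\frac{k\pi t}{T}\,\mathrm{d}t .$$ Let $(Z_k)_{k\in\mathbb{Z}}$ be a sequence of independent standard Gaussian random variables, and let $B=(B_t)_{t\in[0,T]}$ be the stochastic process given by the series expansion $$B_t=\sum_{k=1}^{\infty}\sqrt{-\frac{c_k}{2}}\left(Z_k\sin\frac{k\pi t}{T}+Z_{-k}\left(1-\cos\frac{k\pi t}{T}\right)\right),\qquad t\in[0,T],$$ where the series is assumed to converge in mean square for every $t\in[0,T]$. Then $$\forall (s,t)\in[0,T]^2,\qquad \mathbf{E}(B_sB_t)=\frac12\left(t^{2H}+s^{2H}-|t-s|^{2H}\right).$$
   Context: The coefficients satisfy $c_k\le 0$ for all $k\ge 1$, so the square roots are real nonnegative numbers. *)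

(* Defs.v *)
From HB Require Import structures.
From mathcomp Require Import all_boot all_order all_algebra.
From mathcomp Require Import all_classical all_reals all_analysis.

Set Implicit Arguments.
Unset Strict Implicit.
Unset Printing Implicit Defensive.

Import Order.TTheory GRing.Theory Num.Theory.
Import numFieldNormedType.Exports.

Local Open Scope classical_set_scope.
Local Open Scope ring_scope.

(* Mutual independence: a list J without repetition stands for a finite
   subfamily of the index type. *)
Definition mutually_independent (R : realType) (d : measure_display)
    (Om : measurableType d) (P : probability Om R) (I : eqType)
    (X : I -> {RV P >-> R}) : Prop :=
  forall (J : seq I) (A : I -> set R), uniq J ->
    (forall j, j \in J -> measurable (A j)) ->
    P (\bigcap_(j in [set` J]) (X j @^-1` A j))
      = (\prod_(j <- J) P (X j @^-1` A j))%E.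

(* The parameters of normal_prob are the mean and the standard deviation. *)
Definition standard_gaussian (R : realType) (d : measure_display)
    (Om : measurableType d) (P : probability Om R) (X : {RV P >-> R}) : Prop :=
  forall A : set R, measurable A -> distribution P X A = normal_prob 0 1 A.

Definition mean_square_cvg (R : realType) (d : measure_display)
    (Om : measurableType d) (P : probability Om R)
    (S : nat -> Om -> R) (Y : Om -> R) : Prop :=
  'E_P[(fun w => `|S n w - Y w| ^+ 2)%R]%E @[n --> \oo] --> 0%E.

Definition fourier_coef (R : realType) (T H : R) (k : nat) : R :=
  2 / T * \int[lebesgue_measure]_(t in `[0, T])
            (t `^ (2 * H) * cos (k%:R * pi * t / T)).

(* MathComp's Num.sqrt is 0 on negative arguments; it is only used here at
   - fourier_coef T H k / 2, which is nonnegative for k >= 1 and 0 < H < 1/2. *)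
Definition series_term (R : realType) (Om : Type) (T H : R)
    (Z : int -> Om -> R) (t : R) (k : nat) (w : Om) : R :=
  Num.sqrt (- fourier_coef T H k / 2) *
    (Z k%:Z w * sin (k%:R * pi * t / T)
     + Z (- k%:Z) w * (1 - cos (k%:R * pi * t / T))).

Definition partial_sum (R : realType) (Om : Type) (T H : R)
    (Z : int -> Om -> R) (t : R) (n : nat) (w : Om) : R :=
  \sum_(1 <= k < n.+1) series_term T H Z t k w.

(* Main.v *)
Require Import Defs.
From HB Require Import structures.
From mathcomp Require Import all_boot all_order all_algebra.
From mathcomp Require Import all_classical all_reals all_analysis.
From mathcomp Require Import measurable_realfun ring lra zify.

(** The covariance of the partial sums is computed exactly and its limit is
    then identified.

    Independent standard Gaussian variables are orthonormal in L2, so that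
    with c_k = fourier_coef T H k <= 0 and w = pi / T, for the partial sums
    S_n of the expansion, E (S_n(s) S_n(t)) is the sum over 1 <= k <= n of
      - c_k / 2 * (sin (k w s) sin (k w t)
                   + (1 - cos (k w s)) (1 - cos (k w t))).
    The addition formula turns this into
      1 / 2 * (p_n(t) + p_n(s) - p_n(|t - s|)),
    where p_n(x) is the sum over 1 <= k <= n of - c_k * (1 - cos (k w x))
    (inner_partial_sum).  The mean-square limit carries E (S_n(s) S_n(t)) to
    E (B_s B_t) (inner_cvg), hence it remains to see that p_n(x) tends to
    x^(2H) for every x in [0, T].

    Now p_n(x) is the difference of the n-th cosine partial sums of t^(2H) at x
    and at 0.  The Fejer means of a continuous function
    converge pointwise (fejer), so the arithmetic means of p_n(x) tend to
    x^(2H) (cesaro_power_partial_sum).  No convergence theorem for the Fourier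
    series itself has to be proved: p_n(x) = E (S_n(x)^2) converges because
    S_n(x) converges in mean square, and its limit must agree with the limit
    of its arithmetic means.

    The Fejer theorem is obtained from three facts, in the manner of
    Korovkin: the Fejer kernel is nonnegative, being a sum of two squares; the
    Fejer means of the test function (cos (w y) - cos (w x))^2 at x tend to 0;
    and a continuous f satisfies
    |f y - f x| <= e + C (cos (w y) - cos (w x))^2 on [0, T].

    The sign of c_k, needed for the square roots, comes from a comparison with
    a function whose derivative dominates t^(2H) cos (k w t)
    (Rintegral_powR_cos_le). *)

Set Implicit Arguments.
Unset Strict Implicit.
Unset Printing Implicit Defensive.

Import Order.TTheory GRing.Theory Num.Theory.
Import numFieldNormedType.Exports.

Local Open Scope classical_set_scope.
Local Open Scope ring_scope.

(** * Fejer means of cosine series *)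

(** The classical identity behind the positivity of the Fejer kernel: the
    right-hand side is the squared modulus of the sum of the exp (i j z).
    Passing from n to n + 1 adds
    1 + 2 * Re (exp (i n z) * conj (sum of the exp (i j z))). *)
Lemma sum_dirichlet_kernel (R : realType) (z : R) (n : nat) :
  \sum_(0 <= N < n) (1 + 2 * \sum_(1 <= k < N.+1) cos (k%:R * z)) =
  (\sum_(0 <= j < n) cos (j%:R * z)) ^+ 2
  + (\sum_(0 <= j < n) sin (j%:R * z)) ^+ 2.
Proof.
elim: n => [|n IHn]; first by rewrite !big_geq// expr0n addr0.
rewrite big_nat_recr//= IHn [\sum_(0 <= j < n.+1) cos _]big_nat_recr//=.
rewrite [\sum_(0 <= j < n.+1) sin _]big_nat_recr//= !sqrrD.
suff -> : \sum_(1 <= k < n.+1) cos (k%:R * z) =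
    (\sum_(0 <= j < n) cos (j%:R * z)) * cos (n%:R * z)
    + (\sum_(0 <= j < n) sin (j%:R * z)) * sin (n%:R * z).
  by have := cos2Dsin2 (n%:R * z); move: (cos _) (sin _) => c s cs; lra.
rewrite !mulr_suml -big_split/= big_add1/= big_nat_rev/= add0n.
apply: eq_big_nat => j /andP[_ jn]; rewrite -cosB -[RHS]cosN opprB.
by congr cos; rewrite subnSK// natrB ?(ltnW jn)// mulrBl.
Qed.

Lemma Rintegral_FTC (R : realType) (F f : R -> R) (a b : R) : a < b ->
  (forall x : R, is_derive x 1 F (f x)) -> continuous f ->
  \int[lebesgue_measure]_(x in `[a, b]) f x = F b - F a.
Proof.
move=> ab dF cf; have cF : continuous F.
  by move=> y; apply/differentiable_continuous/derivable1_diffP.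
rewrite /Rintegral (@continuous_FTC2 _ _ F)//.
- exact: continuous_subspaceT.
- split=> [x _|//|]; first exact: ex_derive.
  + by apply: cvg_at_right_filter; exact: cF.
  + by apply: cvg_at_left_filter; exact: cF.
- by move=> x _; rewrite derive1E derive_val.
Qed.

(** With a = x / 2 and b = y / 2, the difference of the two sides is
    4 cos a sin b sin (a - b), and all three factors are nonnegative. *)
Lemma ler_cosB (R : realType) (x y : R) : 0 <= y -> y <= x -> x <= pi ->
  1 - cos (x - y) <= cos y - cos x.
Proof.
move=> y0 yx xpi.
have [-> ->] : x = (x / 2) *+ 2 /\ y = (y / 2) *+ 2 by split; lra.
have : 0 <= cos (x / 2) * (sin (y / 2) * sin (x / 2 - y / 2)).
  apply: mulr_ge0; first by apply: cos_ge0_pihalf; apply/andP; split; lra.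
  by apply: mulr_ge0; apply: sin_ge0_pi; apply/andP; split; lra.
rewrite cosB sinB !cos_mulr2n !sin_mulr2n.
have := cos2Dsin2 (y / 2).
move: (cos (x / 2)) (sin (x / 2)) (cos (y / 2)) (sin (y / 2)) => a sa b sb hb h.
rewrite -subr_ge0.
have -> : b ^+ 2 *+ 2 - 1 - (a ^+ 2 *+ 2 - 1) -
    (1 - ((a ^+ 2 *+ 2 - 1) * (b ^+ 2 *+ 2 - 1) +
      (a * sa) *+ 2 * ((b * sb) *+ 2))) =
    4 * (a * (sb * (sa * b - a * sb))) + 4 * a ^+ 2 * (b ^+ 2 + sb ^+ 2 - 1).
  by ring.
by rewrite hb subrr mulr0 addr0 mulr_ge0.
Qed.

Section cosine_series.
Context {R : realType} (T : R) (T_gt0 : 0 < T).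
Implicit Types (f g : R -> R) (x y : R) (n N k : nat).

Let mu := @lebesgue_measure R.

Definition cos_mode k y : R := cos (k%:R * pi * y / T).

Definition cos_coef f k : R :=
  2 / T * \int[mu]_(y in `[0, T]) (f y * cos_mode k y).

Definition cos_partial_sum f x N : R :=
  cos_coef f 0 / 2 + \sum_(1 <= k < N.+1) cos_coef f k * cos_mode k x.

(** Kernel of the cosine partial sums on [0, T]; it is not a function of
    x - y alone, because the even extension of f adds the reflected point. *)
Definition dirichlet_kernel x N y : R :=
  1 + 2 * \sum_(1 <= k < N.+1) cos_mode k x * cos_mode k y.

(** The product of cosines splits into cosines of the sum and of the
    difference of the arguments, which reduces to sum_dirichlet_kernel. *)
Lemma sum_dirichlet_kernel_ge0 x y n :
  0 <= \sum_(0 <= N < n) dirichlet_kernel x N y.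
Proof.
pose z1 := pi * (x - y) / T; pose z2 := pi * (x + y) / T.
rewrite (_ : \sum_(0 <= N < n) _ = 2^-1 *
   (\sum_(0 <= N < n) (1 + 2 * \sum_(1 <= k < N.+1) cos (k%:R * z1))
  + \sum_(0 <= N < n) (1 + 2 * \sum_(1 <= k < N.+1) cos (k%:R * z2)))).
  by rewrite !sum_dirichlet_kernel mulr_ge0// !addr_ge0// sqr_ge0.
rewrite -big_split/= mulr_sumr; apply: eq_bigr => N _.
rewrite /dirichlet_kernel (_ : \sum_(1 <= k < N.+1) (cos_mode k x * _) = 2^-1 *
  (\sum_(1 <= k < N.+1) cos (k%:R * z1)
   + \sum_(1 <= k < N.+1) cos (k%:R * z2))); last first.
  rewrite -big_split/= mulr_sumr; apply: eq_bigr => k _.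
  rewrite /cos_mode (_ : k%:R * z1 = k%:R * pi * x / T - k%:R * pi * y / T);
    last by rewrite /z1; ring.
  rewrite (_ : k%:R * z2 = k%:R * pi * x / T + k%:R * pi * y / T);
    last by rewrite /z2; ring.
  by rewrite cosB cosD; lra.
by lra.
Qed.

Lemma continuous_cos_mode k : continuous (cos_mode k).
Proof.
move=> y; apply: continuous_comp; last exact: continuous_cos.
by apply: cvgM; [apply: cvgM; [exact: cvg_cst|exact: cvg_id]|exact: cvg_cst].
Qed.

Definition cont f := {within `[0, T], continuous f}.

Lemma integrable_cont f : cont f -> mu.-integrable `[0, T] (EFin \o f).
Proof.
move=> cf; apply: continuous_compact_integrable => //.
exact: segment_compact.
Qed.

Lemma contM f g : cont f -> cont g -> cont (fun y => f y * g y).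
Proof. by move=> cf cg y; apply: cvgM; [exact: cf|exact: cg]. Qed.

Lemma contD f g : cont f -> cont g -> cont (fun y => f y + g y).
Proof. by move=> cf cg y; apply: cvgD; [exact: cf|exact: cg]. Qed.

Lemma cont_continuous f : continuous f -> cont f.
Proof. by move=> ?; exact: continuous_subspaceT. Qed.

Lemma cont_cst c : cont (fun=> c).
Proof. exact/cont_continuous/cst_continuous. Qed.

Lemma cont_cos_mode k : cont (cos_mode k).
Proof. exact/cont_continuous/continuous_cos_mode. Qed.

#[local] Hint Resolve cont_cst cont_cos_mode : core.

Lemma cont_sum (F : nat -> R -> R) (r : seq nat) : (forall k, cont (F k)) ->
  cont (fun y => \sum_(k <- r) F k y).
Proof.
move=> cF; elim: r => [|k r IHr].
  by under eq_fun do rewrite big_nil; exact: cont_cst.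
by under eq_fun do rewrite big_cons; exact: contD.
Qed.

Lemma cont_dirichlet_kernel x N : cont (dirichlet_kernel x N).
Proof.
by apply: contD => //; apply: contM => //; apply: cont_sum => k; exact: contM.
Qed.

Lemma Rintegral_sum (F : nat -> R -> R) m n : (forall k, cont (F k)) ->
  \int[mu]_(y in `[0, T]) (\sum_(m <= k < n) F k y) =
  \sum_(m <= k < n) \int[mu]_(y in `[0, T]) (F k y).
Proof.
move=> cF; rewrite /index_iota; elim: (iota m (n - m)) => [|k s IHs].
  rewrite big_nil; under eq_Rintegral do rewrite big_nil.
  by rewrite Rintegral_cst ?mul0r.
rewrite big_cons -IHs -RintegralD//.
- by apply: eq_Rintegral => y _; rewrite big_cons.
- exact: integrable_cont.
- exact/integrable_cont/cont_sum.
Qed.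

Lemma cos_partial_sumE f x N : cont f ->
  cos_partial_sum f x N =
  T^-1 * \int[mu]_(y in `[0, T]) (f y * dirichlet_kernel x N y).
Proof.
move=> cf; rewrite /cos_partial_sum /cos_coef.
have -> : \int[mu]_(y in `[0, T]) (f y * dirichlet_kernel x N y) =
    \int[mu]_(y in `[0, T]) (f y * cos_mode 0 y) +
    \sum_(1 <= k < N.+1) \int[mu]_(y in `[0, T])
      (2 * cos_mode k x * (f y * cos_mode k y)).
  rewrite -Rintegral_sum => [|k]; last first.
    by apply: contM => //; exact: contM.
  rewrite -RintegralD//; last 2 first.
    exact/integrable_cont/contM.
    apply/integrable_cont/cont_sum => k.
    by apply: contM => //; exact: contM.
  apply: eq_Rintegral => y _; rewrite /dirichlet_kernel mulrDr; congr (_ + _).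
    by rewrite /cos_mode !mul0r cos0.
  by rewrite mulrA mulr_sumr; apply: eq_bigr => k _; ring.
rewrite mulrDr; congr (_ + _); first by field; rewrite gt_eqF.
rewrite mulr_sumr; apply: eq_bigr => k _; rewrite RintegralZl//; first by ring.
exact/integrable_cont/contM.
Qed.

Definition fejer_kernel x n y : R :=
  n.+1%:R^-1 * \sum_(0 <= N < n.+1) dirichlet_kernel x N y.

Definition fejer_mean f x : R^nat := arithmetic_mean (cos_partial_sum f x).

Lemma fejer_meanE f x n : cont f ->
  fejer_mean f x n =
  T^-1 * \int[mu]_(y in `[0, T]) (f y * fejer_kernel x n y).
Proof.
move=> cf; have cD N : cont (fun y => f y * dirichlet_kernel x N y).
  by apply: contM => //; exact: cont_dirichlet_kernel.
rewrite /fejer_mean /arithmetic_mean/= seriesEnat/=.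
under eq_bigr do rewrite cos_partial_sumE//.
rewrite -mulr_sumr -Rintegral_sum// mulrCA; congr (_ * _).
rewrite -RintegralZl//; last first.
  exact: integrable_cont (cont_sum cD).
by apply: eq_Rintegral => y _; rewrite /fejer_kernel mulrCA [in RHS]mulr_sumr.
Qed.

Lemma Rintegral_cos_mode k : (0 < k)%N ->
  \int[mu]_(y in `[0, T]) cos_mode k y = 0.
Proof.
move=> k_gt0; pose w : R := k%:R * pi / T.
have w_gt0 : 0 < w by rewrite divr_gt0// mulr_gt0 ?pi_gt0// ltr0n.
pose F y := w^-1 * sin (w * y).
have dF (y : R) : is_derive y 1 F (cos_mode k y).
  rewrite /F; apply: is_derive_eq.
  rewrite /GRing.scale/= /cos_mode.
  rewrite (_ : w * y = k%:R * pi * y / T); last by rewrite /w; ring.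
  rewrite !(mulr0, add0r, addr0, mulr1).
  by rewrite mulrCA mulVf ?mulr1// gt_eqF.
rewrite (Rintegral_FTC T_gt0 dF); last exact: continuous_cos_mode.
rewrite /F mulr0 sin0 mulr0 subr0 /w divfK ?gt_eqF//.
rewrite -[_ * pi]add0r mulr_natl (alternatingn (@sinDpi R)).
by rewrite sin0 !mulr0.
Qed.

Lemma cos_modeM j k y : (j <= k)%N ->
  cos_mode j y * cos_mode k y =
  2^-1 * (cos_mode (k - j) y + cos_mode (k + j) y).
Proof.
move=> jk; rewrite /cos_mode natrB// natrD.
rewrite !mulrBl !mulrDl cosB cosD; lra.
Qed.

Lemma cos_mode0 y : cos_mode 0 y = 1.
Proof. by rewrite /cos_mode !mul0r cos0. Qed.

Lemma Rintegral_T (c : R) : \int[mu]_(y in `[0, T]) c = c * T.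
Proof.
rewrite Rintegral_cst//= lebesgue_measure_itv/= lte_fin T_gt0.
by rewrite sube0.
Qed.

(** The product formula reduces orthogonality to integrals of single modes,
    which vanish over [0, T] except for the mode 0. *)
Lemma Rintegral_cos_modeM j k : (0 < k)%N ->
  \int[mu]_(y in `[0, T]) (cos_mode j y * cos_mode k y) =
  if j == k then T / 2 else 0.
Proof.
wlog jk : j k / (j <= k)%N => [th|] k_gt0.
  have [jk|kj] := leqP j k; first exact: th.
  under eq_Rintegral do rewrite mulrC.
  by rewrite th ?(ltnW kj)// ?(leq_ltn_trans _ kj)// eq_sym.
under eq_Rintegral do rewrite cos_modeM//.
rewrite RintegralZl//; last exact: integrable_cont (contD _ _).
rewrite RintegralD//; try exact: integrable_cont.
rewrite [X in _ + X]Rintegral_cos_mode ?addn_gt0 ?k_gt0// addr0.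
case: eqVneq => [->|jk'].
  under eq_Rintegral do rewrite subnn cos_mode0.
  by rewrite Rintegral_T mul1r mulrC.
by rewrite Rintegral_cos_mode ?mulr0// subn_gt0 ltn_neqAle jk'.
Qed.

Lemma cos_coef_mode j k : (0 < j)%N -> cos_coef (cos_mode j) k = (j == k)%:R.
Proof.
move=> j_gt0; rewrite /cos_coef; under eq_Rintegral do rewrite mulrC.
rewrite Rintegral_cos_modeM// eq_sym; case: eqP => _; last by rewrite mulr0.
by rewrite mulr1n; field; rewrite gt_eqF.
Qed.

Lemma cos_partial_sum_mode j x N : (0 < j <= N)%N ->
  cos_partial_sum (cos_mode j) x N = cos_mode j x.
Proof.
move=> /andP[j_gt0 jN]; rewrite /cos_partial_sum cos_coef_mode//.
rewrite (gtn_eqF j_gt0) mul0r add0r (big_cat_nat (n := j))//=; last exact: leqW.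
rewrite big_nat_cond big1 ?add0r => [|k /andP[/andP[_ kj] _]]; last first.
  by rewrite cos_coef_mode// gtn_eqF// mul0r.
rewrite big_ltn// cos_coef_mode// eqxx mul1r big_nat_cond big1 ?addr0//.
by move=> k /andP[/andP[kj _] _]; rewrite cos_coef_mode// ltn_eqF// mul0r.
Qed.

Lemma cos_partial_sum_cst c x N : cos_partial_sum (fun=> c) x N = c.
Proof.
rewrite /cos_partial_sum big_nat_cond big1 ?addr0 => [|k /andP[/andP[k0 _] _]].
  rewrite /cos_coef; under eq_Rintegral do rewrite cos_mode0 mulr1.
  by rewrite Rintegral_T; field; rewrite gt_eqF.
rewrite /cos_coef RintegralZl//; last exact: integrable_cont.
by rewrite Rintegral_cos_mode// !mulr0 mul0r.
Qed.

Lemma cos_partial_sum_lin f g a x N : cont f -> cont g ->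
  cos_partial_sum (fun y => f y + a * g y) x N =
  cos_partial_sum f x N + a * cos_partial_sum g x N.
Proof.
move=> cf cg.
have coefD k : cos_coef (fun y => f y + a * g y) k =
    cos_coef f k + a * cos_coef g k.
  rewrite /cos_coef mulrCA -mulrDr; congr (_ * _).
  rewrite -RintegralZl//; last exact: integrable_cont (contM _ _).
  rewrite -RintegralD//; last 2 first.
  - exact: integrable_cont (contM _ _).
  - by apply: integrable_cont; apply: contM => //; exact: contM.
  by apply: eq_Rintegral => y _; ring.
rewrite /cos_partial_sum coefD.
under eq_bigr do rewrite coefD mulrDl -mulrA.
by rewrite big_split/= -mulr_sumr; ring.
Qed.

(** On [0, T] the function cos (pi y / T) is injective, so this trigonometric
    polynomial in y vanishes only at x; that makes it a test function for
    pointwise convergence at x. *)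
Definition korovkin_test x y := (cos_mode 1 y - cos_mode 1 x) ^+ 2.

Lemma korovkin_testE x : korovkin_test x =
  fun y => (2^-1 + cos_mode 1 x ^+ 2 + (- 2 * cos_mode 1 x) * cos_mode 1 y)
           + 2^-1 * cos_mode 2 y.
Proof.
apply/funext => y; rewrite /korovkin_test sqrrB [cos_mode 1 y ^+ 2]expr2.
by rewrite cos_modeM// subnn addn1 cos_mode0; field.
Qed.

(** The test function is a combination of the modes 0, 1 and 2, hence it is
    equal to its partial sums from N = 2 on, and it vanishes at x. *)
Lemma cos_partial_sum_korovkin x N : (2 <= N)%N ->
  cos_partial_sum (korovkin_test x) x N = 0.
Proof.
move=> N2; have N1 : (1 <= N)%N by exact: leq_trans N2.
rewrite korovkin_testE !cos_partial_sum_lin//; last first.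
  by apply: contD => //; exact: contM.
rewrite !cos_partial_sum_cst !cos_partial_sum_mode//.
have := cos_modeM x (leqnn 1); rewrite subnn addn1 cos_mode0.
rewrite -expr2 => h.
have -> : cos_mode 2 x = 2 * cos_mode 1 x ^+ 2 - 1 by rewrite h; field.
by field.
Qed.

Lemma fejer_mean_korovkin x : fejer_mean (korovkin_test x) x @ \oo --> 0.
Proof.
apply: cesaro; apply: cvg_near_cst.
by exists 2 => // N /= N2; apply/eqP; rewrite cos_partial_sum_korovkin.
Qed.

Lemma cont_korovkin x : cont (korovkin_test x).
Proof.
by apply: contM; apply: contD.
Qed.

Lemma fejer_mean_lin f g a x n : cont f -> cont g ->
  fejer_mean (fun y => f y + a * g y) x n =
  fejer_mean f x n + a * fejer_mean g x n.
Proof.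
move=> cf cg; rewrite /fejer_mean /arithmetic_mean/= !seriesEnat/=.
under eq_bigr do rewrite cos_partial_sum_lin//.
by rewrite big_split/= -mulr_sumr; ring.
Qed.

Lemma fejer_mean_cst c x n : fejer_mean (fun=> c) x n = c.
Proof.
rewrite /fejer_mean /arithmetic_mean/= seriesEnat/=.
under eq_bigr do rewrite cos_partial_sum_cst//.
rewrite big_const_nat iter_addr addr0 subn0 -[c *+ _]mulr_natl mulKf//.
Qed.

(** Monotonicity is where the positivity of the kernel enters. *)
Lemma le_fejer_mean f g x n : cont f -> cont g ->
  (forall y, y \in `[0, T] -> f y <= g y) ->
  fejer_mean f x n <= fejer_mean g x n.
Proof.
move=> cf cg fg; rewrite !fejer_meanE//.
have cK : cont (fejer_kernel x n).
  apply: contM; first exact: cont_cst.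
  by apply: cont_sum => k; exact: cont_dirichlet_kernel.
rewrite ler_pM2l ?invr_gt0//; apply: le_Rintegral => //.
- exact: integrable_cont (contM _ _).
- exact: integrable_cont (contM _ _).
- move=> y yT; apply: ler_wpM2r; last exact: fg.
  by rewrite mulr_ge0// sum_dirichlet_kernel_ge0.
Qed.

(** The comparison ler_cosB and the monotonicity of cos on [0, pi] give a lower
    bound that is uniform in x and y, including at the end points, where the
    derivative of cos vanishes. *)
Lemma korovkin_test_ge x y e : x \in `[0, T] -> y \in `[0, T] ->
  0 < e -> e <= T -> e <= `|x - y| ->
  0 < 1 - cos (pi * e / T) /\
  (1 - cos (pi * e / T)) ^+ 2 <= korovkin_test x y.
Proof.
wlog yx : x y / y <= x => [th|].
  move=> xT yT e0 eT exy; have [yx|xy] := lerP y x; first exact: th.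
  have -> : korovkin_test x y = korovkin_test y x.
    by rewrite /korovkin_test -sqrrN opprB.
  by apply: th => //; [exact: ltW|rewrite distrC].
rewrite !in_itv/= => /andP[x0 xT] /andP[y0 yT] e_gt0 eT.
rewrite ger0_norm ?subr_ge0// => exy.
have piT : 0 < pi / T by rewrite divr_gt0// pi_gt0.
have piTE z : pi * z / T = (pi / T) * z by rewrite mulrAC.
have piTT : pi / T * T = pi by rewrite divfK// gt_eqF.
have c1 : cos (pi * e / T) < 1.
  rewrite -[ltRHS]cos0 ltr_cos ?in_itv/= ?lexx ?pi_ge0// piTE.
    by rewrite mulr_gt0.
  by rewrite mulr_ge0 ?(ltW piT) ?(ltW e_gt0)//= -[leRHS]piTT ler_pM2l.
split; first by rewrite subr_gt0.
have le_pi z : z <= T -> pi / T * z <= pi.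
  by move=> zT; rewrite -[leRHS]piTT ler_pM2l.
have ge_0 z : 0 <= z -> 0 <= pi / T * z by move=> z0; rewrite mulr_ge0// ltW.
have : 1 - cos (pi / T * (x - y)) <= cos (pi / T * y) - cos (pi / T * x).
  by rewrite mulrBr; apply: ler_cosB; rewrite ?ler_pM2l ?le_pi ?ge_0.
move=> le_cos.
have le_e : 1 - cos (pi * e / T) <= 1 - cos (pi / T * (x - y)).
  rewrite lerB// piTE le_eqVlt.
  have [->|ne] := eqVneq e (x - y); first by rewrite eqxx.
  have ex : e < x - y by rewrite lt_neqAle ne.
  rewrite ltr_cos ?in_itv/= ?ge_0 ?le_pi ?ltr_pM2l ?ex ?orbT//; try by lra.
rewrite /korovkin_test /cos_mode mul1r [_ * y / T]mulrAC [_ * x / T]mulrAC.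
have c0 : 0 <= 1 - cos (pi * e / T) by rewrite subr_ge0 cos_le1.
rewrite lerXn2r ?nnegrE//; first exact: le_trans (le_trans le_e le_cos).
exact: le_trans le_cos.
Qed.

(** Near x continuity gives e; away from x the crude bound 2 M on the
    difference is absorbed by the lower bound of the test function. *)
Lemma korovkin_bound f x e : cont f -> x \in `[0, T] -> 0 < e ->
  exists2 C, 0 <= C &
    forall y, y \in `[0, T] -> `|f y - f x| <= e + C * korovkin_test x y.
Proof.
move=> cf xT e_gt0.
have [M M_ge] : exists M, forall y, y \in `[0, T] -> `|f y| <= M.
  have cnf : cont (fun y => `|f y|).
    by move=> y; apply: cvg_norm; exact: cf.
  have [c _ cM] := EVT_max (ltW T_gt0) cnf.
  by exists `|f c|.
have [d d_gt0 df] : exists2 d, 0 < d &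
    forall y, y \in `[0, T] -> `|x - y| < d -> `|f y - f x| < e.
  have /(subspace_continuousP _) /(_ _ xT) /cvgrPdist_lt /(_ _ e_gt0) := cf.
  rewrite near_withinE => /nbhs_ballP[d /= d_gt0 df]; exists d => // y yT xy.
  by rewrite distrC; exact: df.
have dT : 0 < Num.min d T by rewrite lt_min d_gt0.
set c := (1 - cos (pi * Num.min d T / T)) ^+ 2.
exists (2 * M / c) => [|y yT].
  rewrite mulr_ge0 ?invr_ge0 ?sqr_ge0// mulr_ge0//.
  by apply: le_trans (M_ge _ xT).
have [xy|xy] := ltP `|x - y| d.
  rewrite -[leLHS]addr0 lerD ?(ltW (df _ _ _))// mulr_ge0 ?sqr_ge0//.
  rewrite mulr_ge0 ?invr_ge0 ?sqr_ge0// mulr_ge0//.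
  by apply: le_trans (M_ge _ xT).
have minT : Num.min d T <= T by rewrite ge_min lexx orbT.
have minxy : Num.min d T <= `|x - y| by rewrite ge_min xy.
have [c_gt0 le_c] := korovkin_test_ge xT yT dT minT minxy.
have c0 : 0 < c by rewrite exprn_gt0.
apply: (@le_trans _ _ (2 * M)).
  apply: le_trans (ler_normB _ _) _.
  by have := M_ge _ xT; have := M_ge _ yT; lra.
apply: (@le_trans _ _ (2 * M / c * korovkin_test x y)); last first.
  by rewrite lerDr ltW.
rewrite -mulrA ler_peMr//; last by rewrite ler_pdivlMl// mulr1.
by rewrite mulr_ge0// (le_trans _ (M_ge _ xT)).
Qed.

(** The Fejer mean at x is a positive linear functional fixing constants, so
    the two-sided bound korovkin_bound passes to the means, where the test
    function contributes a term tending to 0. *)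
Theorem fejer f x : cont f -> x \in `[0, T] ->
  fejer_mean f x @ \oo --> f x.
Proof.
move=> cf xT; apply/cvgrPdist_le => e e_gt0.
have e2 : 0 < e / 2 by rewrite divr_gt0.
have [C C_ge0 fC] := korovkin_bound cf xT e2.
have /cvgrPdist_le := fejer_mean_korovkin x.
move=> /(_ (e / 2 / (C + 1))) [].
  by rewrite divr_gt0// ltr_wpDl.
move=> m _ mP; exists m => // n /= mn.
have := mP _ mn; rewrite sub0r normrN => /ler_normlP[_] kn.
have cK : cont (korovkin_test x) by exact: cont_korovkin.
have Ck : C * fejer_mean (korovkin_test x) x n <= e / 2.
  apply: (@le_trans _ _ (C * (e / 2 / (C + 1)))); first exact: ler_wpM2l.
  rewrite mulrCA ler_piMr ?(ltW e2)// ler_pdivrMr ?ltr_wpDl//; lra.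
have up : fejer_mean f x n <=
    fejer_mean (fun y => (f x + e / 2) + C * korovkin_test x y) x n.
  apply: le_fejer_mean => //; first by apply: contD => //; exact: contM.
  by move=> y yT; have /ler_normlP[] := fC _ yT; lra.
have lo : fejer_mean (fun y => (f x - e / 2) + (- C) * korovkin_test x y) x n
    <= fejer_mean f x n.
  apply: le_fejer_mean => //; first by apply: contD => //; exact: contM.
  by move=> y yT; have /ler_normlP[] := fC _ yT; lra.
move: up lo; rewrite !fejer_mean_lin ?fejer_mean_cst//; try exact: cont_cst.
by move=> up lo; apply/ler_normlP; split; lra.
Qed.

End cosine_series.

(** * Cosine coefficients of a power function *)

Section cosine_power_integral.
Context {R : realType}.
Let mu := @lebesgue_measure R.

Lemma powR_small (a e : R) : 0 < a -> 0 < e ->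
  forall y, 0 <= y -> y < e `^ a^-1 -> y `^ a < e.
Proof.
move=> a0 e0 y y0 ye; have -> : e = (e `^ a^-1) `^ a.
  by rewrite -powRrM mulVf ?powRr1 ?gt_eqF// ltW.
by rewrite gt0_ltr_powR ?nnegrE ?powR_ge0.
Qed.

Lemma within_continuous_powR (a T : R) : 0 < a ->
  {within `[0, T], continuous (fun t => t `^ a)}.
Proof.
move=> a0; apply/subspace_continuousP => x; rewrite /= in_itv/= => /andP[].
rewrite le_eqVlt => /predU1P[<- _|x0 xT]; last first.
  apply: cvg_within_filter.
  apply/differentiable_continuous/derivable1_diffP/derivable_powR.
  by rewrite in_itv/= x0.
rewrite /from_subspace /= powR0 ?gt_eqF//; apply/cvgrPdist_lt => e e0.
rewrite near_withinE; apply/nbhs_ballP; exists (e `^ a^-1) => /=.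
  exact: powR_gt0.
move=> y; rewrite /ball/= sub0r normrN in_itv/= => ye /andP[y0 _].
rewrite sub0r normrN ger0_norm ?powR_ge0// powR_small//.
by rewrite -(ger0_norm y0).
Qed.

Lemma onem_cos_le (u : R) : 0 <= u -> 1 - cos u <= u.
Proof.
move=> u0; pose f (x : R) := x + cos x.
have df (x : R) : is_derive x 1 f (1 - sin x) by apply: is_derive_eq.
have cf : continuous f.
  by move=> y; apply/differentiable_continuous/derivable1_diffP.
have := @ger0_derive1_le_cc _ f 0 u.
move=> /(_ _ _ _ 0 u) H.
suff : f 0 <= f u by rewrite /f cos0; lra.
apply: H; rewrite ?in_itv/= ?lexx ?u0//.
- by move=> x _; rewrite derive1E derive_val subr_ge0 sin_le1.
- exact: continuous_subspaceT.
Qed.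

Section sign.
Context (a w : R) (a_gt0 : 0 < a) (a_lt1 : a < 1) (w_gt0 : 0 < w).

(** Two formal integrations by parts of t^a cos (w t), stopped before the
    last integral: the remaining term a (1 - a) t^(a - 2) (1 - cos (w t)) / w^2
    of the derivative is nonnegative for a < 1. *)
Definition powR_cos_majorant (t : R) := w^-1 * (t `^ a * sin (w * t)) -
  a * w^-1 ^+ 2 * (t `^ (a - 1) * (1 - cos (w * t))).

Lemma is_derive_powR_cos_majorant (t : R) : 0 < t ->
  is_derive t 1 powR_cos_majorant
  (t `^ a * cos (w * t)
   + a * (1 - a) * w^-1 ^+ 2 * (t `^ (a - 2) * (1 - cos (w * t)))).
Proof.
move=> t0; rewrite /powR_cos_majorant.
have dp (b : R) : is_derive t 1 (fun t => t `^ b) (b * t `^ (b - 1)).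
  exact: is_derive1_powR.
apply: is_derive_eq.
rewrite /GRing.scale/= !(mulr0, add0r, addr0, mulr1).
rewrite (_ : a - 1 - 1 = a - 2); last by ring.
move: (powR t _) (powR t (a - 1)) (powR t (a - 2)) => p p1 p2.
by field; rewrite gt_eqF.
Qed.

(** When the sine vanishes at the right end, the majorant is nonpositive
    there, and its increments dominate those of the integral.  As t^(a - 1) is
    singular at 0, the comparison is made on [e, T] and e then tends to 0. *)
Lemma Rintegral_powR_cos_le (T : R) : 0 < T -> sin (w * T) = 0 ->
  \int[mu]_(t in `[0, T]) (t `^ a * cos (w * t)) <= 0.
Proof.
move=> T0 sinT; pose f t := t `^ a * cos (w * t).
have ccos : continuous (fun t : R => cos (w * t)).
  move=> t; apply: continuous_comp; last exact: continuous_cos.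
  by apply: cvgM; [exact: cvg_cst|exact: cvg_id].
have cf : {within `[0, T], continuous f}.
  move=> t; apply: cvgM; first exact: within_continuous_powR.
  exact: continuous_subspaceT.
have intf : mu.-integrable `[0, T] (EFin \o f).
  by apply: continuous_compact_integrable => //; exact: segment_compact.
pose I x := \int[mu]_(t in `[0, x]) f t.
rewrite -/(I T) leNgt; apply/negP => IT_gt0.
pose K := T + (1 + a) / w.
have K_gt0 : 0 < K by rewrite addr_gt0// divr_gt0// addr_gt0.
suff IK (e : R) : 0 < e -> e < T -> I T <= K * e `^ a.
  pose e := Num.min (T / 2) ((I T / K) `^ a^-1 / 2).
  have e_gt0 : 0 < e by rewrite lt_min !divr_gt0// powR_gt0// divr_gt0.
  have eT : e < T by rewrite gt_min; apply/orP; left; lra.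
  have := IK _ e_gt0 eT; rewrite leNgt => /negP; apply.
  rewrite -ltr_pdivlMl// mulrC powR_small//; [exact: divr_gt0|exact: ltW|].
  rewrite gt_min; apply/orP; right.
  have : 0 < (I T / K) `^ a^-1 by rewrite powR_gt0// divr_gt0.
  lra.
move=> e_gt0 eT.
(* The derivative of the difference is the nonnegative remainder term. *)
have Phi_le : powR_cos_majorant e - I e <= powR_cos_majorant T - I T.
  have dI (x : R) : x \in `]e, T[ -> derivable I x 1 /\ I^`()%classic x = f x.
    rewrite in_itv/= => /andP[ex xT]; have x0 := lt_trans e_gt0 ex.
    apply: (continuous_FTC1_closed xT intf x0).
    apply: continuousM; last exact: ccos.
    apply/differentiable_continuous/derivable1_diffP/derivable_powR.
  by rewrite in_itv/= x0.
  have dG (x : R) : x \in `]e, T[ -> is_derive x 1 (powR_cos_majorant)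
    (f x
     + a * (1 - a) * w^-1 ^+ 2 * (x `^ (a - 2) * (1 - cos (w * x)))).
    rewrite in_itv/= => /andP[ex xT]; apply: is_derive_powR_cos_majorant.
    exact: lt_trans ex.
  apply: (@ger0_derive1_le_cc _ (fun x => powR_cos_majorant x - I x) e T).
  - move=> x xeT; apply: derivableB; last exact: (dI x xeT).1.
    by case: (dG x xeT).
  - move=> x xeT; have [d1 d2] := dI x xeT; have [d3 d4] := dG x xeT.
    rewrite derive1E deriveB// -(derive1E I) d2 d4 addrAC subrr add0r.
    rewrite !mulr_ge0 ?sqr_ge0 ?powR_ge0 ?subr_ge0 ?cos_le1 ?invr_ge0//;
      exact: ltW.
  - move=> x; apply: cvgB.
      apply: continuous_in_subspaceT => y.
      rewrite inE/= in_itv/= => /andP[ey _].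
      apply/differentiable_continuous/derivable1_diffP.
      by case: (is_derive_powR_cos_majorant (lt_le_trans e_gt0 ey)).
    apply: (@continuous_subspaceW _ _ _ `[0, T]); last first.
      exact: (parameterized_integral_continuous (ltW T0) intf).
    by apply: subset_itvr; rewrite bnd_simp ltW.
  - by rewrite in_itv/= lexx ltW.
  - by rewrite in_itv/= lexx ltW.
  - exact: ltW.
have Ie : I e <= T * e `^ a.
  apply: (@le_trans _ _ (\int[mu]_(t in `[0, e]) (e `^ a))).
    apply: le_Rintegral => //.
    - apply: integrableS intf => //.
      by apply: subset_itvl; rewrite bnd_simp ltW.
    - apply: continuous_compact_integrable => //; first exact: segment_compact.
      exact/continuous_subspaceT/cst_continuous.
    - move=> t; rewrite /= in_itv/= => /andP[t0 te].
      apply: (@le_trans _ _ (t `^ a)).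
        by rewrite ler_piMr ?powR_ge0 ?cos_le1.
      by rewrite ge0_ler_powR ?nnegrE// ltW.
  rewrite Rintegral_cst//= lebesgue_measure_itv/= lte_fin e_gt0 sube0/=.
  by rewrite mulrC ler_wpM2r ?powR_ge0// ltW.
have GT : powR_cos_majorant T <= 0.
  rewrite /powR_cos_majorant sinT !mulr0 sub0r oppr_le0.
  rewrite !mulr_ge0 ?sqr_ge0 ?powR_ge0 ?subr_ge0 ?cos_le1 ?invr_ge0//;
    exact: ltW.
have Ge : - powR_cos_majorant e <= (1 + a) / w * e `^ a.
  have c1 : a * w^-1 ^+ 2 * (e `^ (a - 1) * (1 - cos (w * e))) <=
      a / w * e `^ a.
    have -> : a / w * e `^ a = a * w^-1 ^+ 2 * (e `^ (a - 1) * (w * e)).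
      by rewrite -(mulr_powRB1 (ltW e_gt0) a_gt0); field; rewrite gt_eqF.
    apply: ler_wpM2l; first by rewrite mulr_ge0 ?sqr_ge0 ?(ltW a_gt0).
    apply: ler_wpM2l; first exact: powR_ge0.
    by rewrite onem_cos_le// mulr_ge0// ltW.
  have c2 : - (w^-1 * (e `^ a * sin (w * e))) <= w^-1 * e `^ a.
    rewrite -mulrN ler_pM2l ?invr_gt0// -mulrN ler_piMr ?powR_ge0//.
  rewrite /powR_cos_majorant opprB mulrDl mul1r mulrDl; lra.
rewrite /K mulrDl; lra.
Qed.

End sign.
End cosine_power_integral.

(** * Second moments of the standard normal law *)

Section normal_density.
Context {R : realType}.
Let mu := @lebesgue_measure R.

(** The density agrees almost everywhere with the Radon-Nikodym derivative,
    which satisfies the change of variables formula. *)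
Lemma ge0_integral_normal_prob (m s : R) (f : R -> \bar R) :
  measurable_fun setT f -> (forall x, 0 <= f x)%E ->
  (\int[normal_prob m s]_x f x = \int[mu]_x (f x * (normal_pdf m s x)%:E))%E.
Proof.
move=> mf f0; have dom := normal_prob_dominates m s.
have mphi : measurable_fun setT (fun x => (normal_pdf m s x)%:E).
  by apply/measurable_EFinP; exact: measurable_normal_pdf.
rewrite -(Radon_Nikodym_SigmaFinite.change_of_variables dom)//.
have RNi := Radon_Nikodym_SigmaFinite.f_integrable dom.
apply: ae_eq_integral => //.
- by apply: emeasurable_funM => //; exact: measurable_int RNi.
- exact: emeasurable_funM.
- apply: ae_eqe_mul2l; apply: integral_ae_eq => // E _ mE.
  by rewrite -Radon_Nikodym_SigmaFinite.f_integral.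
Qed.

Notation phi := (@normal_pdf R 0 1).

Lemma cvg_integral_itvNnn (f : R -> R) : measurable_fun setT f ->
  (forall x, 0 <= f x) ->
  (\int[mu]_(x in `[(- n%:R)%R, n%:R]) (f x)%:E)%E @[n --> \oo]
    --> (\int[mu]_x (f x)%:E)%E.
Proof.
move=> mf f0.
pose g (n : nat) (x : R) := ((EFin \o f) \_ `[- n%:R, n%:R]) x.
have -> : (fun n : nat => \int[mu]_(x in `[(- n%:R)%R, n%:R]) (f x)%:E)%E =
    (fun n => \int[mu]_x g n x)%E.
  by apply/funext => n; rewrite integral_mkcond.
have -> : (\int[mu]_x (f x)%:E = \int[mu]_x (limn (g^~ x)))%E.
  apply: eq_integral => x _; apply/esym/cvg_lim => //; apply: cvg_near_cst.
  exists (Num.truncn `|x|).+1 => // n /= xn; rewrite /g patchE ifT//.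
  rewrite inE/= in_itv/= -ler_norml ltW//.
  by apply: lt_le_trans (truncnS_gt _) _; rewrite ler_nat.
apply: cvg_monotone_convergence => //.
- move=> n; apply/(measurable_restrictT _ _).1 => //.
  exact/measurable_funTS/measurable_EFinP.
- by move=> n x _; rewrite /g patchE; case: ifPn => // _; rewrite lee_fin.
- move=> x _ n k nk; rewrite /g !patchE; case: ifPn => [|_].
    rewrite inE/= in_itv/= => /andP[nx xn]; rewrite ifT// inE/= in_itv/=.
    have : n%:R <= k%:R :> R by rewrite ler_nat.
    by move=> ?; apply/andP; split; lra.
  by case: ifPn => // _; rewrite lee_fin.
Qed.

Lemma is_derive_normal_pdf (x : R) : is_derive x 1 phi (- x * phi x).
Proof.
rewrite normal_pdfE ?oner_eq0// /normal_fun.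
apply: is_derive_eq.
rewrite /GRing.scale/=.
by rewrite subr0 !expr1n; field.
Qed.

Lemma normal_pdfN (x : R) : phi (- x) = phi x.
Proof. by rewrite normal_pdfE ?oner_eq0// /normal_fun !subr0 sqrrN. Qed.

(** Already 1 + n^2 / 2 <= exp (n^2 / 2) makes this O(1 / n). *)
Lemma cvg_natM_normal_pdf : n%:R * phi n%:R @[n --> \oo] --> 0.
Proof.
apply: (@squeeze_cvgr _ _ _ _ (fun=> 0)
  (fun n => 4 * normal_peak 1 * n.+1%:R^-1)).
- near=> n; rewrite mulr_ge0 ?normal_pdf_ge0//=.
  rewrite normal_pdfE ?oner_eq0// /normal_fun subr0 expr1n [leLHS]mulrCA.
  rewrite [leRHS](_ : _ = normal_peak 1 * (4 / n.+1%:R)); last by ring.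
  apply: ler_wpM2l; first exact: normal_peak_ge0.
  rewrite mulNr expRN.
  have := expR_ge1Dx (n%:R ^+ 2 / (1 *+ 2) : R).
  have e0 := expR_gt0 (n%:R ^+ 2 / (1 *+ 2) : R).
  move: (expR _) e0 => y y0 yn.
  rewrite ler_pdivrMr// mulrAC ler_pdivlMr ?ltr0n// -natr1.
  have : 0 <= n%:R :> R by [].
  move: (n%:R) yn => z yn z0; nra.
- exact: cvg_cst.
- rewrite -[0](mulr0 (4 * normal_peak 1)).
  by apply: cvgM; [exact: cvg_cst|exact: cvg_harmonic].
Unshelve. all: by end_near. Qed.

(** Mean and variance at once: knowing the second moments of x + c for two
    values of c determines both, and only nonnegative integrands occur.  The
    function F x = - (x + 2 c) phi x has derivative
    ((x + c)^2 - (c^2 + 1)) phi x, and F n - F (- n) = - 2 n phi n. *)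
Lemma integral_sqrD_normal_pdf (c : R) :
  (\int[mu]_x ((x + c) ^+ 2 * phi x)%:E = (c ^+ 2 + 1)%:E)%E.
Proof.
pose f x := (x + c) ^+ 2 * phi x.
have cphi : continuous phi by exact: continuous_normal_pdf (oner_neq0 _).
have cf : continuous f.
  move=> x; apply: cvgM; last exact: cphi.
  by apply: cvgM; apply: cvgD; (exact: cvg_id || exact: cvg_cst).
have f0 x : 0 <= f x by rewrite mulr_ge0 ?sqr_ge0 ?normal_pdf_ge0.
have mf : measurable_fun setT f by exact: continuous_measurable_fun.
have itg (g : R -> R) (n : nat) : continuous g ->
    mu.-integrable `[- n%:R, n%:R] (EFin \o g).
  move=> cg; apply: continuous_compact_integrable; first exact: segment_compact.
  exact: continuous_subspaceT.
have fE (n : nat) : (0 < n)%N ->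
    (\int[mu]_(x in `[(- n%:R)%R, n%:R]) (f x)%:E =
     (c ^+ 2 + 1)%:E * \int[mu]_(x in `[(- n%:R)%R, n%:R]) (phi x)%:E
     - (2 * (n%:R * phi n%:R))%:E)%E.
  move=> n0.
  pose F (x : R) := - (x + 2 * c) * phi x.
  have dF (x : R) : is_derive x 1 F (f x - (c ^+ 2 + 1) * phi x).
    rewrite /F; have dphi := is_derive_normal_pdf x.
    apply: is_derive_eq; rewrite /GRing.scale/= /f; ring.
  have nn : - n%:R < n%:R :> R by rewrite gtrN// ltr0n.
  have cphi' : continuous (fun x => (c ^+ 2 + 1) * phi x).
    by move=> x; apply: cvgM; [exact: cvg_cst|exact: cphi].
  have := Rintegral_FTC nn dF.
  rewrite RintegralB//; [|exact: itg|exact: itg].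
  rewrite RintegralZl//; last exact: itg.
  rewrite {2}/F normal_pdfN.
  have {}cphi' : continuous (fun x => f x - (c ^+ 2 + 1) * phi x).
    by move=> x; apply: cvgB; [exact: cf|exact: cphi'].
  move=> /(_ cphi'); rewrite /Rintegral => H.
  rewrite -[LHS]fineK ?integrable_fin_num//; last exact: itg.
  rewrite -[X in (_ * X)%E]fineK ?integrable_fin_num//; last exact: itg.
  rewrite -EFinM -EFinB; congr EFin.
  move: H; rewrite /F; set u := fine _; set v := fine _; move: u v => u v H.
  by rewrite -[u](subrK ((c ^+ 2 + 1) * v)) H; ring.
have lim1 := cvg_integral_itvNnn mf f0.
have lim2 :=
  cvg_integral_itvNnn (measurable_normal_pdf 0 1) (normal_pdf_ge0 0 1).
rewrite integral_normal_pdf in lim2.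
have lim3 : ((c ^+ 2 + 1)%:E * \int[mu]_(x in `[(- n%:R)%R, n%:R]) (phi x)%:E
     - (2 * (n%:R * phi n%:R))%:E)%E @[n --> \oo] -->
    ((c ^+ 2 + 1)%:E * 1 - 0%:E)%E.
  have lim0 : 2 * (n%:R * phi n%:R) @[n --> \oo] --> 0.
    rewrite -[X in _ --> X](mulr0 2); apply: cvgM; first exact: cvg_cst.
    exact: cvg_natM_normal_pdf.
  apply: cvgeB => //; first exact: cvgeZl.
  apply: cvg_EFin; [by near=> n|exact: lim0].
rewrite mule1 sube0 in lim3.
apply/esym; apply: cvg_unique lim3 _ => //.
apply: cvg_trans lim1; apply: near_eq_cvg; near=> n.
by apply: fE; near: n; exists 1.
Unshelve. all: by end_near. Qed.

End normal_density.

Section gaussian_moments.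
Context {R : realType} {d : measure_display} {Om : measurableType d}
  {P : probability Om R}.

Context (X : {RV P >-> R}) (gX : standard_gaussian X).

(** The measurable structure on R carried by random variables and the one
    carried by the Lebesgue measure have the same sets but different displays,
    so X is first seen as a map into the latter. *)
Lemma gaussian_sqrD (c : R) :
  (\int[P]_w ((X w + c) ^+ 2)%:E = (c ^+ 2 + 1)%:E)%E.
Proof.
have mf : measurable_fun setT (fun x : R => ((x + c) ^+ 2)%:E).
  by apply/measurable_EFinP; apply: measurable_funX; exact: measurable_funD.
have f0 (x : R) : (0 <= ((x + c) ^+ 2)%:E)%E by rewrite lee_fin sqr_ge0.
have mX : @measurable_fun _ _ Om (measurableTypeR R) setT X.
  by move=> _ B mB; exact: (@measurable_funP _ _ _ _ setT X).
have mf' : @measurable_fun _ _ (measurableTypeR R) _ setT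
    (fun x : R => ((x + c) ^+ 2)%:E).
  by move=> _ B mB; exact: mf.
have := @ge0_integral_pushforward _ _ _ _ _ _ mX P setT _ measurableT mf'
  (fun x _ => f0 x).
rewrite preimage_setT /comp/= => <-.
transitivity (\int[normal_prob 0 1]_x ((x + c) ^+ 2)%:E)%E.
  by apply: eq_measure_integral => A mA _; exact: gX.
rewrite ge0_integral_normal_prob// -integral_sqrD_normal_pdf.
by apply: eq_integral => x _; rewrite EFinM.
Qed.

Lemma gaussian_integrable_sqr :
  P.-integrable setT (EFin \o (fun w => X w ^+ 2)).
Proof.
apply/integrableP; split.
  by apply/measurable_EFinP; exact: measurable_funX.
rewrite (eq_integral (fun w => ((X w + 0) ^+ 2)%:E)) => [|w _].
  by rewrite gaussian_sqrD ltry.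
by rewrite /= addr0 ger0_norm ?sqr_ge0.
Qed.

Lemma gaussian_integrable : P.-integrable setT (EFin \o X).
Proof.
have : P.-integrable setT (EFin \o (fun w => 1 + X w ^+ 2)).
  have c1 : P.-integrable setT (EFin \o cst 1).
    exact: finite_measure_integrable_cst.
  exact: (integrableD measurableT c1 gaussian_integrable_sqr).
apply: le_integrable => //; first exact/measurable_EFinP.
move=> w _ /=; rewrite lee_fin [leRHS]ger0_norm ?addr_ge0 ?sqr_ge0//.
by rewrite -[X w ^+ 2]real_normK ?num_real//; move: (`|_|) => y; nra.
Qed.

Lemma gaussian_sqr : \int[P]_w (X w ^+ 2) = 1.
Proof.
rewrite /Rintegral (eq_integral (fun w => ((X w + 0) ^+ 2)%:E)) => [|w _].
  by rewrite gaussian_sqrD expr0n add0r.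
by rewrite addr0.
Qed.

Lemma gaussian_mean : \int[P]_w X w = 0.
Proof.
pose f w : R := X w ^+ 2.
have if2 : P.-integrable setT (EFin \o f) by exact: gaussian_integrable_sqr.
have iX := gaussian_integrable.
have E1 : \int[P]_w (X w + 1) ^+ 2 = 2.
  by rewrite /Rintegral gaussian_sqrD expr1n.
have E2 : \int[P]_w f w = 1 by exact: gaussian_sqr.
have c1 : P.-integrable setT (EFin \o cst 1).
  exact: finite_measure_integrable_cst.
have i2X : P.-integrable setT (EFin \o (fun w => 2 * X w)).
  exact: (integrableZl measurableT 2 iX).
have : \int[P]_w (X w + 1) ^+ 2 = \int[P]_w (f w + (2 * X w + 1)).
  by apply: eq_Rintegral => w _; rewrite /f; ring.
rewrite RintegralD//; last exact: (integrableD measurableT i2X c1).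
rewrite RintegralD// RintegralZl// Rintegral_cst//.
rewrite [X in fine X]probability_setT.
by rewrite E1 E2 /=; lra.
Qed.

End gaussian_moments.

(** * Square-integrable functions and mean-square limits *)

Section L2.
Context {R : realType} {d : measure_display} {Om : measurableType d}
  {P : probability Om R}.
Implicit Types X Y : Om -> R.

Definition L2 X := measurable_fun setT X /\
  P.-integrable setT (EFin \o (fun w => X w ^+ 2)).

(** Instead of the Cauchy-Schwarz inequality, |X Y| <= X^2 + Y^2. *)
Lemma L2_integrableM X Y : L2 X -> L2 Y ->
  P.-integrable setT (EFin \o (fun w => X w * Y w)).
Proof.
move=> [mX iX] [mY iY].
apply: le_integrable (integrableD measurableT iX iY) => //.
  by apply/measurable_EFinP; exact: measurable_funM.
move=> w _ /=; rewrite lee_fin [leRHS]ger0_norm ?addr_ge0 ?sqr_ge0//.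
rewrite normrM -[X w ^+ 2]real_normK ?num_real//.
rewrite -[Y w ^+ 2]real_normK ?num_real//.
by move: `|X w| `|Y w| (normr_ge0 (X w)) (normr_ge0 (Y w)) => x y x0 y0; nra.
Qed.

Lemma L2D X Y : L2 X -> L2 Y -> L2 (fun w => X w + Y w).
Proof.
move=> lX lY; have iXY := L2_integrableM lX lY.
case: lX lY => [mX iX] [mY iY]; split; first exact: measurable_funD.
rewrite (_ : (fun w => _) =
    fun w => X w ^+ 2 + (X w * Y w + (X w * Y w + Y w ^+ 2))).
  exact: (integrableD measurableT iX (integrableD measurableT iXY
    (integrableD measurableT iXY iY))).
by apply/funext => w; ring.
Qed.

Lemma L2Z (a : R) X : L2 X -> L2 (fun w => a * X w).
Proof.
move=> [mX iX]; split; first exact: measurable_funM.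
rewrite (_ : (fun w => _) = fun w => a ^+ 2 * X w ^+ 2).
  exact: (integrableZl measurableT (a ^+ 2) iX).
by apply/funext => w; ring.
Qed.

Lemma L2B X Y : L2 X -> L2 Y -> L2 (fun w => X w - Y w).
Proof.
move=> lX lY; rewrite (_ : (fun w => _) = fun w => X w + (-1) * Y w).
  exact/L2D/L2Z.
by apply/funext => w; ring.
Qed.

Lemma L2_sum (I : Type) (s : seq I) (F : I -> Om -> R) :
  (forall i, L2 (F i)) -> L2 (fun w => \sum_(i <- s) F i w).
Proof.
move=> lF; elim: s => [|i s IHs].
  under eq_fun do rewrite big_nil; split=> //.
  rewrite (_ : _ \o _ = cst 0%E); first exact: integrable0.
  by apply/funext => w /=; rewrite expr0n.
by under eq_fun do rewrite big_cons; exact: L2D.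
Qed.

Definition inner X Y : R := \int[P]_w (X w * Y w).

Lemma innerC X Y : inner X Y = inner Y X.
Proof. by apply: eq_Rintegral => w _; rewrite mulrC. Qed.

Lemma innerDl X Y V : L2 X -> L2 Y -> L2 V ->
  inner (fun w => X w + Y w) V = inner X V + inner Y V.
Proof.
move=> lX lY lV; rewrite /inner -RintegralD//; [|exact: L2_integrableM..].
by apply: eq_Rintegral => w _; rewrite mulrDl.
Qed.

Lemma innerZl a X V : L2 X -> L2 V ->
  inner (fun w => a * X w) V = a * inner X V.
Proof.
move=> lX lV; rewrite /inner -RintegralZl//; last exact: L2_integrableM.
by apply: eq_Rintegral => w _; rewrite mulrA.
Qed.

Lemma inner_suml (I : Type) (s : seq I) (a : I -> R) (F : I -> Om -> R) V :
  (forall i, L2 (F i)) -> L2 V ->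
  inner (fun w => \sum_(i <- s) a i * F i w) V =
  \sum_(i <- s) a i * inner (F i) V.
Proof.
move=> lF lV; elim: s => [|i s IHs].
  rewrite big_nil /inner; under eq_Rintegral do rewrite big_nil mul0r.
  by rewrite Rintegral_cst// mul0r.
rewrite big_cons -IHs -innerZl// -innerDl//; last 2 first.
- exact: L2Z.
- by apply: L2_sum => j; exact: L2Z.
by apply: eq_Rintegral => w _; rewrite big_cons.
Qed.

Lemma inner_orthonormal_sum (I : eqType) (s : seq I) (a b : I -> R)
    (F : I -> Om -> R) :
  (forall i, L2 (F i)) -> (forall i j, inner (F i) (F j) = (i == j)%:R) ->
  uniq s ->
  inner (fun w => \sum_(i <- s) a i * F i w)
    (fun w => \sum_(i <- s) b i * F i w)
  = \sum_(i <- s) a i * b i.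
Proof.
move=> lF oF us; rewrite inner_suml//; last by apply: L2_sum => i; exact: L2Z.
apply: eq_big_seq => i si; congr (_ * _).
rewrite innerC inner_suml// (bigD1_seq i)//=.
rewrite oF eqxx mulr1 big1 ?addr0// => j ji.
by rewrite oF (negbTE ji) mulr0.
Qed.

(** The difference U V - X Y is X E + D Y + D E with D = U - X and E = V - Y.
    Weighting |X E| <= (l X^2 + E^2 / l) / 2 and |D Y| likewise makes the
    terms with X and Y small by the choice of l, and those with D and E small
    by letting n grow. *)
Lemma inner_cvg (U V : nat -> Om -> R) X Y :
  (forall n, L2 (U n)) -> (forall n, L2 (V n)) -> L2 X -> L2 Y ->
  inner (fun w => U n w - X w) (fun w => U n w - X w) @[n --> \oo] --> 0 ->
  inner (fun w => V n w - Y w) (fun w => V n w - Y w) @[n --> \oo] --> 0 ->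
  inner (U n) (V n) @[n --> \oo] --> inner X Y.
Proof.
move=> lU lV lX lY cU cV.
pose D n w := U n w - X w; pose E n w := V n w - Y w.
have lD n : L2 (D n) by exact: L2B.
have lE n : L2 (E n) by exact: L2B.
pose K := inner X X + inner Y Y.
have sqE W : inner W W = \int[P]_w (W w ^+ 2).
  by apply: eq_Rintegral => w _; rewrite expr2.
have inner_ge0 W : 0 <= inner W W.
  by rewrite sqE; apply: Rintegral_ge0 => w _; exact: sqr_ge0.
have K0 : 0 <= K by rewrite addr_ge0.
have bound n (l : R) : 0 < l -> `|inner X Y - inner (U n) (V n)| <=
    l / 2 * K + (1 + l^-1) / 2 * (inner (D n) (D n) + inner (E n) (E n)).
  move=> l0.
  pose g w := l / 2 * (X w * X w + Y w * Y w) +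
    (1 + l^-1) / 2 * (D n w * D n w + E n w * E n w).
  have iS W W' : L2 W -> L2 W' ->
      P.-integrable setT (EFin \o (fun w => W w * W w + W' w * W' w)).
    move=> lW lW'.
    exact: (integrableD measurableT
      (L2_integrableM lW lW) (L2_integrableM lW' lW')).
  have ig1 : P.-integrable setT
      (EFin \o (fun w => l / 2 * (X w * X w + Y w * Y w))).
    exact: (integrableZl measurableT (l / 2) (iS _ _ lX lY)).
  have ig2 : P.-integrable setT
      (EFin \o (fun w => (1 + l^-1) / 2 * (D n w * D n w + E n w * E n w))).
    exact: (integrableZl measurableT _ (iS _ _ (lD n) (lE n))).
  have iB : P.-integrable setT
      (EFin \o (fun w => X w * Y w - U n w * V n w)).
    exact: (integrableB measurableT
      (L2_integrableM lX lY) (L2_integrableM (lU n) (lV n))).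
  rewrite -RintegralB//; [|exact: L2_integrableM..].
  apply: le_trans (le_normr_Rintegral _ _) _ => //.
  rewrite (_ : _ + _ = \int[P]_w g w).
    apply: le_Rintegral => //.
    - exact: integrable_norm.
    - exact: (integrableD measurableT ig1 ig2).
    move=> w _; rewrite /g /D /E.
    move: (X w) (Y w) (U n w) (V n w) => x y u v.
    have l_neq0 : l != 0 by rewrite gt_eqF.
    apply/ler_normlP; split; rewrite -subr_ge0.
      rewrite (_ : _ - _ =
        l^-1 / 2 * ((l * x - (v - y)) ^+ 2 + (l * y - (u - x)) ^+ 2)
        + 2^-1 * ((u - x) - (v - y)) ^+ 2); last by field.
      rewrite addr_ge0// mulr_ge0 ?addr_ge0 ?sqr_ge0//.
      by rewrite divr_ge0// invr_ge0 ltW.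
    rewrite (_ : _ - _ =
      l^-1 / 2 * ((l * x + (v - y)) ^+ 2 + (l * y + (u - x)) ^+ 2)
      + 2^-1 * ((u - x) + (v - y)) ^+ 2); last by field.
    by rewrite addr_ge0// mulr_ge0 ?addr_ge0 ?sqr_ge0// divr_ge0// invr_ge0 ltW.
  rewrite RintegralD// !RintegralZl//; [|exact: iS..].
  by rewrite !RintegralD//; exact: L2_integrableM.
apply/cvgrPdist_le => e e0.
pose l := e / (K + 1).
have l0 : 0 < l by rewrite divr_gt0// ltr_wpDl.
have cDE : inner (D n) (D n) + inner (E n) (E n) @[n --> \oo] --> 0.
  by rewrite -[0]addr0; exact: cvgD.
move/cvgrPdist_le : cDE => /(_ (e / (1 + l^-1))).
have l1 : 0 < 1 + l^-1 by rewrite addr_gt0// invr_gt0.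
rewrite divr_gt0// => /(_ isT)[m _ mP]; exists m => // n /= mn.
apply: le_trans (bound n l l0) _.
have := mP _ mn; rewrite /= sub0r normrN => /ler_normlP[_].
rewrite ler_pdivlMr//.
have : l * K <= e by rewrite /l mulrAC ler_pdivrMr ?ltr_wpDl// ler_pM2l//; lra.
move: (_ + inner _ _) (1 + l^-1) => x y; lra.
Qed.

End L2.

(** * Independent Gaussian variables are orthonormal *)

Section indep.
Context {R : realType} {d : measure_display} {Om : measurableType d}
  {P : probability Om R}.

(** By uniqueness of the product measure, the law of (X, Y) is the product of
    the laws of X and Y; the Fubini theorem does the rest. *)
Lemma Rintegral_indepM (X Y : {RV P >-> R}) :
  (forall A B : set R, measurable A -> measurable B ->
    P (X @^-1` A `&` Y @^-1` B) = (P (X @^-1` A) * P (Y @^-1` B))%E) ->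
  L2 (P := P) X -> L2 (P := P) Y ->
  P.-integrable setT (EFin \o X) -> P.-integrable setT (EFin \o Y) ->
  \int[P]_w (X w * Y w) = (\int[P]_w X w) * (\int[P]_w Y w).
Proof.
move=> XY lX lY iX iY.
have iXY := L2_integrableM lX lY.
pose h w := (X w, Y w).
have mh : measurable_fun setT h by exact: measurable_fun_pair.
pose f (z : R * R) := (z.1 * z.2)%:E.
have mf : measurable_fun setT f.
  apply/measurable_EFinP; apply: measurable_funM.
    exact: measurable_fst.
  exact: measurable_snd.
have ipf : (pushforward P h).-integrable setT f.
  exact: (integrable_pushforward mh mf).
have prodE (A : set (R * R)) : measurable A ->
  (distribution P X \x distribution P Y)%E A = pushforward P h A.
  apply: product_measure_unique => B C mB mC.
  exact: XY.
have ipf' : (distribution P X \x distribution P Y)%E.-integrable setT f.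
  apply/integrableP; split=> //.
  case/integrableP: ipf => _; apply: le_lt_trans.
  rewrite le_eqVlt (eq_measure_integral (pushforward P h)) ?eqxx//.
  by move=> A mA _; exact: prodE.
have : (\int[P]_w (X w * Y w)%:E =
    (\int[P]_w X w)%:E * (\int[P]_w Y w)%:E)%E.
  transitivity (\int[pushforward P h]_z f z)%E.
    by rewrite (integral_pushforward mh mf).
  transitivity (\int[distribution P X \x distribution P Y]_z f z)%E.
    by apply: eq_measure_integral => A mA _; exact/esym/prodE.
  rewrite -integral12_prod_meas1//=.
  have EY (x : R) :
      (\int[distribution P Y]_y f (x, y) = x%:E * (\int[P]_w Y w)%:E)%E.
    rewrite integral_distribution//; last first.
    - exact: (integrableZl measurableT x iY).
    - exact: measurableT_comp mf (measurable_pair1 x).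
    rewrite /f /Rintegral fineK ?integrable_fin_num//.
    by rewrite -integralZl//; apply: eq_integral => w _; rewrite /= EFinM.
  rewrite (eq_integral (fun x : R => x%:E * (\int[P]_w Y w)%:E)%E); last first.
    by move=> x _; exact: EY.
  rewrite integral_distribution.
  - rewrite [in RHS]/Rintegral [X in _ = (X * _)%E]fineK ?integrable_fin_num//=.
    by rewrite -integralZr.
  - exact: emeasurable_funM.
  - exact: (integrableZr measurableT _ iX).
by rewrite /Rintegral => ->.
Qed.

Lemma mutually_independent_pair (I : eqType) (Z : I -> {RV P >-> R}) (i j : I) :
  mutually_independent Z -> i != j ->
  forall A B : set R, measurable A -> measurable B ->
    P (Z i @^-1` A `&` Z j @^-1` B) = (P (Z i @^-1` A) * P (Z j @^-1` B))%E.
Proof.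
move=> indZ ij A B mA mB; pose C k := if k == i then A else B.
have Ci : C i = A by rewrite /C eqxx.
have Cj : C j = B by rewrite /C eq_sym (negbTE ij).
have := indZ [:: i; j] C; rewrite !big_cons.
rewrite big_nil mule1 /= inE ij Ci Cj => <-//.
  congr (P _); apply/seteqP; split=> w /=.
    by move=> [wA wB] k /=; rewrite !inE => /orP[]/eqP ->; rewrite ?Ci ?Cj.
  move=> H; split; [rewrite -Ci|rewrite -Cj]; apply: H;
    by rewrite /= !inE eqxx ?orbT.
by move=> k _; rewrite /C; case: ifP.
Qed.

Lemma gaussian_L2 (X : {RV P >-> R}) : standard_gaussian X -> L2 (P := P) X.
Proof. by move=> gX; split => //; exact: gaussian_integrable_sqr. Qed.

Lemma gaussian_orthonormal (I : eqType) (Z : I -> {RV P >-> R}) :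
  mutually_independent Z -> (forall i, standard_gaussian (Z i)) ->
  forall i j, inner (P := P) (Z i) (Z j) = (i == j)%:R.
Proof.
move=> indZ gZ i j; case: eqVneq => [->|ij].
  rewrite /inner -[RHS](gaussian_sqr (gZ j)).
  by apply: eq_Rintegral => w _; rewrite expr2.
rewrite /inner (Rintegral_indepM (mutually_independent_pair indZ ij)
  (gaussian_L2 (gZ i)) (gaussian_L2 (gZ j))) ?(gaussian_mean (gZ i)) ?mul0r//.
  exact: gaussian_integrable (gZ i).
exact: gaussian_integrable (gZ j).
Qed.

End indep.

(** * Cosine expansion of a power function *)

Section cosine_power.
Context {R : realType} (T H : R).
Context (T_gt0 : 0 < T) (H_gt0 : 0 < H) (H_lt_half : H < 1 / 2).

Lemma fourier_coef_le0 k : (0 < k)%N -> fourier_coef T H k <= 0.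
Proof.
move=> k_gt0; rewrite /fourier_coef pmulr_rle0 ?divr_gt0//.
pose w := k%:R * pi / T.
have wE t : k%:R * pi * t / T = w * t by rewrite /w mulrAC.
under eq_Rintegral do rewrite wE.
apply: Rintegral_powR_cos_le => //.
- by rewrite mulr_gt0.
- by rewrite mulrC -ltr_pdivlMr.
- by rewrite divr_gt0// mulr_gt0 ?pi_gt0// ltr0n.
rewrite /w divfK ?gt_eqF// -[_ * pi]add0r mulr_natl (alternatingn (@sinDpi R)).
by rewrite sin0 mulr0.
Qed.

(** Cosine partial sums of t^(2H) at x, minus those at 0: the constant term
    cancels, which normalises the value at 0. *)
Definition power_partial_sum (x : R) (n : nat) : R :=
  \sum_(1 <= k < n.+1) (- fourier_coef T H k) * (1 - cos_mode T k x).

(** These are differences of Fejer means at x and at 0, and t^(2H) is 0 at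
    0. *)
Lemma cesaro_power_partial_sum (x : R) : x \in `[0, T] ->
  arithmetic_mean (power_partial_sum x) @ \oo --> x `^ (2 * H).
Proof.
move=> xT; pose f t := t `^ (2 * H).
have H2 : 0 < 2 * H by rewrite mulr_gt0.
have cf : cont T f by exact: within_continuous_powR.
have f0 : fejer_mean T f 0 @ \oo --> 0.
  have f00 : f 0 = 0 by rewrite /f powR0 ?gt_eqF.
  rewrite -[X in _ --> X]f00.
  by apply: fejer => //; rewrite in_itv/= lexx ltW.
rewrite -[_ `^ _]subr0.
rewrite (_ : arithmetic_mean _ = fejer_mean T f x \- fejer_mean T f 0).
  by apply: cvgB => //; exact: fejer.
apply/funext => n; rewrite /fejer_mean /arithmetic_mean/= !seriesEnat/=.
rewrite -mulrBr -sumrB; congr (_ * _); apply: eq_bigr => N _.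
rewrite /power_partial_sum /cos_partial_sum opprD addrACA subrr add0r -sumrB.
apply: eq_bigr => k _; rewrite [cos_mode T k 0]/cos_mode mulr0 mul0r cos0 mulr1.
by rewrite -[fourier_coef T H k]/(cos_coef T f k); ring.
Qed.

End cosine_power.

(** * Covariance of the series *)

Section expansion.
Context {R : realType} {d : measure_display} {Om : measurableType d}
  {P : probability Om R} (T H : R) (Z : int -> {RV P >-> R}).
Context (T_gt0 : 0 < T) (H_gt0 : 0 < H) (H_lt_half : H < 1 / 2).
Context (Z_indep : mutually_independent Z)
  (Z_gauss : forall k : int, standard_gaussian (Z k)).

Local Notation S := (partial_sum T H (fun k w => Z k w)).

(** Coefficient of Z i in the expansion at t: the sine terms carry the
    positive indices and the 1 - cos terms the negative ones, so that a partial
    sum is one linear combination of distinct members of Z. *)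
Definition series_coef (t : R) (i : int) : R :=
  Num.sqrt (- fourier_coef T H `|i|%N / 2) *
  (if (0 < i)%R then sin (`|i|%:R * pi * t / T) else 1 - cos_mode T `|i|%N t).

Definition series_index (n : nat) : seq int :=
  [seq k%:Z | k <- index_iota 1 n.+1] ++ [seq - k%:Z | k <- index_iota 1 n.+1].

Lemma uniq_series_index n : uniq (series_index n).
Proof.
rewrite cat_uniq !map_inj_uniq ?iota_uniq//=; last 2 first.
- by move=> i j /oppr_inj [].
- by move=> i j [].
rewrite andbT; apply/hasPn => _ /mapP[k + ->].
rewrite mem_index_iota => /andP[k0 _].
apply/negP => /mapP[j _] /eqP; rewrite eqr_oppLR => /eqP; lia.
Qed.

Lemma sum_series_index (V : nmodType) (F : int -> V) n :
  \sum_(i <- series_index n) F i =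
  \sum_(1 <= k < n.+1) (F k%:Z + F (- k%:Z)).
Proof. by rewrite big_cat !big_map big_split. Qed.

Lemma partial_sumE t n :
  S t n = fun w => \sum_(i <- series_index n) series_coef t i * Z i w.
Proof.
apply/funext => w; rewrite sum_series_index; apply: eq_big_nat => k /andP[k0 _].
rewrite /series_term /series_coef abszN absz_nat ltz_nat k0.
rewrite ifF; last by rewrite oppr_gt0.
by rewrite mulrDr !mulrA /cos_mode; congr (_ + _); rewrite mulrAC.
Qed.

Lemma L2_partial_sum t n : L2 (P := P) (S t n).
Proof. by rewrite partial_sumE; apply: L2_sum => i; exact/L2Z/gaussian_L2. Qed.

Lemma inner_partial_sum s t n :
  inner (P := P) (S s n) (S t n) =
  1 / 2 * (power_partial_sum T H t n + power_partial_sum T H s n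
           - power_partial_sum T H `|t - s| n).
Proof.
rewrite !partial_sumE.
rewrite (inner_orthonormal_sum _ _ _ (gaussian_orthonormal Z_indep Z_gauss)).
- rewrite sum_series_index /power_partial_sum -big_split/= -sumrB mulr_sumr.
  apply: eq_big_nat => k /andP[k0 _].
  have kN : (0 < - k%:Z) = false by rewrite oppr_gt0.
  rewrite /series_coef abszN absz_nat ltz_nat k0 !kN.
  set r := Num.sqrt _.
  have rr : r * r = - fourier_coef T H k / 2.
    by rewrite -expr2 sqr_sqrtr// divr_ge0// oppr_ge0 fourier_coef_le0.
  have -> : cos_mode T k `|t - s| = cos_mode T k t * cos_mode T k s
      + sin (k%:R * pi * t / T) * sin (k%:R * pi * s / T).
    rewrite /cos_mode -cosB -mulrBl -mulrBr -[in RHS]cos_norm !normrM normfV.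
    by rewrite (gtr0_norm T_gt0) (gtr0_norm (pi_gt0 R)) normr_nat.
  by rewrite mulrACA [X in _ + X]mulrACA rr; field.
- by move=> i; exact: gaussian_L2.
- exact: uniq_series_index.
Qed.

Lemma inner_partial_sum_cvg (X Y : {RV P >-> R}) s t :
  mean_square_cvg P (S s) X -> mean_square_cvg P (S t) Y ->
  inner (P := P) (S s n) (S t n) @[n --> \oo] --> inner (P := P) X Y /\
  P.-integrable setT (EFin \o (fun w => X w * Y w)).
Proof.
have L2_lim (W : {RV P >-> R}) x : mean_square_cvg P (S x) W ->
    L2 (P := P) W /\
    inner (P := P) (fun w => S x n w - W w) (fun w => S x n w - W w)
      @[n --> \oo] --> 0.
  rewrite /mean_square_cvg unlock => cW.
  have mSW n : measurable_fun setT (fun w => S x n w - W w).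
    by apply: measurable_funB => //; case: (L2_partial_sum x n).
  have lW : L2 (P := P) W.
    have /fine_cvgP[[m _ fin_m] _] := cW.
    have lSW : L2 (P := P) (fun w => S x m w - W w).
      split=> //; apply/integrableP; split.
        by apply/measurable_EFinP; exact: measurable_funX.
      rewrite (eq_integral (fun w => (`|S x m w - W w| ^+ 2)%:E)) => [|w _].
        by rewrite ltey_eq fin_m/=.
      by rewrite /= normrX.
    have := L2B (L2_partial_sum x m) lSW; congr L2.
    by apply/funext => w; rewrite opprB addrC subrK.
  split=> //.
  apply: cvg_trans (fine_cvg cW); apply: near_eq_cvg; near=> n.
  rewrite /inner /Rintegral /=; congr fine; apply: eq_integral => w _.
  by rewrite real_normK ?num_real// expr2.
move=> /L2_lim[lX cX] /L2_lim[lY cY]; split; last exact: L2_integrableM.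
by apply: inner_cvg => // n; exact: L2_partial_sum.
Unshelve. all: by end_near. Qed.

(** The mean-square convergence at x makes the sequence E (S_n(x)^2)
    convergent; the Cesaro limit then names its limit. *)
Lemma power_partial_sum_cvg (X : {RV P >-> R}) x : x \in `[0, T] ->
  mean_square_cvg P (S x) X ->
  power_partial_sum T H x @ \oo --> x `^ (2 * H).
Proof.
move=> xT cX; have [+ _] := inner_partial_sum_cvg cX cX.
have p0 n : power_partial_sum T H 0 n = 0.
  rewrite /power_partial_sum big1// => k _.
  by rewrite /cos_mode mulr0 mul0r cos0 subrr mulr0.
have -> : (fun n => inner (P := P) (S x n) (S x n)) = power_partial_sum T H x.
  by apply/funext => n; rewrite inner_partial_sum subrr normr0 p0; field.
move=> cp; have cm := cesaro cp.
by have -> := cvg_unique _ (cesaro_power_partial_sum T_gt0 H_gt0 xT) cm.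
Qed.

End expansion.

Theorem theorem3p1 (R : realType) (d : measure_display)
    (Om : measurableType d) (P : probability Om R) (T H : R)
    (Z : int -> {RV P >-> R}) (B : R -> {RV P >-> R})
    (T_gt0 : 0 < T) (H_gt0 : 0 < H) (H_lt_half : H < 1 / 2)
    (Z_indep : mutually_independent Z)
    (Z_gauss : forall k : int, standard_gaussian (Z k))
    (B_series : forall t : R, t \in `[0, T] ->
       mean_square_cvg P (partial_sum T H (fun k w => Z k w) t) (B t)) :
  forall s t : R, s \in `[0, T] -> t \in `[0, T] ->
    'E_P[(fun w => B s w * B t w)%R]%E =
      (1 / 2 * (t `^ (2 * H) + s `^ (2 * H) - `|t - s| `^ (2 * H)))%:E.
Proof.
move=> s t sT tT.
have tsT : `|t - s| \in `[0, T].
  move: sT tT; rewrite !in_itv/= normr_ge0/= => /andP[s0 sT] /andP[t0 tT].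
  by apply/ler_normlP; split; lra.
have cvgp x xT := power_partial_sum_cvg T_gt0 H_gt0 H_lt_half Z_indep Z_gauss
  (x := x) xT (B_series x xT).
have [cst iBB] := inner_partial_sum_cvg Z_gauss
  (B_series s sT) (B_series t tT).
rewrite unlock -[LHS]fineK ?integrable_fin_num//; congr EFin.
apply: cvg_unique cst _ => //=.
under eq_fun do rewrite (inner_partial_sum T_gt0 H_gt0 H_lt_half Z_indep)//.
apply: cvgM; first exact: cvg_cst.
by apply: cvgB; [apply: cvgD|]; exact: cvgp.
Qed.
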